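(* Let $\mathbb{T}$ be the circle of length $2\pi$, let $k_0:\mathbb{T}\to[0,\infty)$ and $c:\mathbb{T}\times[0,\infty)\to[0,\infty)$ be continuous, and let $A_0\in\mathbb{R}^+=[0,\infty)$ be a constant. Assume that $$k_0(x)\ \ge\ \int_0^t e^{-A_0 s}\max_{y\in\mathbb{T}}c(y,s)\,ds\qquad\text{for all }x\in\mathbb{T},\ t\ge0 .$$ Let $k(x,t)$ be the classical non-negative solution of $$k_t=k_{xx}+A_0k-c(x,t),\qquad k(x,0)=k_0(x).$$ Set $$\widetilde{k}_0=\frac1{\pi}\int_{-\pi}^{\pi}k_0(x)\,dx,\qquad \widetilde{c}(t)=\frac1{\pi}\int_{-\pi}^{\pi}c(x,t)\,dx ,$$ and assume that $\widetilde c$ is bounded. Then $$\lim_{t\to\infty}\left[k(x,t)e^{-A_0t}\right]=\widetilde{k}_0-\int_0^\infty e^{-A_0s}\,\widetilde{c}(s)\,ds$$ uniformly in $x\in\mathbb{T}$.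
   Context: $\mathbb{T}$ is $[0,2\pi]$ with endpoints identified; functions on $\mathbb{T}$ are identified with $2\pi$-periodic functions of $x$. A classical solution is a function continuous on $\mathbb{T}\times[0,\infty)$, twice continuously differentiable in $x$ (and differentiable in $t$) for $t>0$, satisfying the partial differential equation for all $x\in\mathbb{T}$, $t>0$, and the initial condition at $t=0$.
   Formalization: The averages of k_0 and c(.,t) are normalized by 1/(2π) instead of the printed 1/π; as printed the claim fails for k_0 = 1, c = 0, A_0 = 0, k = 1, where the limit is 1 but the right-hand side is 2. *)

(* Defs.v *)
From Stdlib Require Import Reals.
From Coquelicot Require Import Coquelicot.
Open Scope R_scope.

(* Functions on the circle of length 2 PI are 2 PI-periodic functions on R;
   functions on (circle) x [0, oo) are f : R -> R -> R, f x t, of which only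
   the values at t >= 0 are ever constrained. *)

Definition periodic (f : R -> R) : Prop := forall x, f (x + 2 * PI) = f x.

Definition continuous_on_cylinder (f : R -> R -> R) : Prop :=
  (forall t, 0 <= t -> periodic (fun x => f x t)) /\
  continuous_on (fun p : R * R => 0 <= snd p) (fun p : R * R => f (fst p) (snd p)).

(* For f continuous and periodic the supremum is finite and attained. *)
Definition circle_max (f : R -> R) : R :=
  real (Lub_Rbar (fun r => exists y, r = f y)).

(* With the prefactor 1/PI instead, the convergence of k(x,t) e^(- A0 t) to
   (average of k0) - int_0^oo e^(- A0 s) (average of c(.,s)) ds would already
   fail for k = k0 = 1, c = 0, A0 = 0: the limit is 1, and
   1/PI * int_(-PI)^PI 1 = 2. *)
Definition circle_average (f : R -> R) : R :=
  1 / (2 * PI) * RInt f (- PI) PI.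

(* [Derive] is total, so differentiability of f and of f' is required
   separately. *)
Definition C2 (f : R -> R) : Prop :=
  forall x, ex_derive f x /\ ex_derive (Derive f) x /\
            continuous (Derive (Derive f)) x.

Definition classical_solution
    (A0 : R) (c : R -> R -> R) (k0 : R -> R) (k : R -> R -> R) : Prop :=
  continuous_on_cylinder k /\
  (forall t, 0 < t -> C2 (fun y => k y t)) /\
  (forall x t, 0 < t -> ex_derive (fun s => k x s) t) /\
  (forall x t, 0 < t ->
     Derive (fun s => k x s) t =
       Derive (Derive (fun y => k y t)) x + A0 * k x t - c x t) /\
  (forall x, k x 0 = k0 x).

(* [fct_UniformSpace] carries the sup-norm balls, so this is uniform
   convergence in x as t -> +oo. *)
Definition uniform_limit_at_infinity (u : R -> R -> R) (l : R) : Prop :=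
  filterlim (fun t => (fun x => u x t) : fct_UniformSpace R R_UniformSpace)
    (Rbar_locally p_infty)
    (locally ((fun _ => l) : fct_UniformSpace R R_UniformSpace)).

(* Main.v *)
Require Import Defs.
From Stdlib Require Import Reals ZArith Lra Lia IndefiniteDescription.
From Coquelicot Require Import Coquelicot.
Open Scope R_scope.

(* Put v = k e^(-A0 t) and g = c e^(-A0 t), so that v_t = v_xx - g with v, g >= 0,
   and let m(t) be the maximum of g(., t).  Everything follows from the maximum
   principle, which needs only pointwise derivatives.
   - Mass: the average of v(., t) is that of k0 minus the integral over [0, t] of
     the average of g.
   - Oscillation: v(p + x, t) - v(p - x, t) vanishes for x = 0 and x = PI, hence is
     dominated by an exponentially decaying barrier plus the integral of m.
   By hypothesis the integral of m over [0, oo) is finite; starting the second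
   estimate at a late time T makes the contribution of m arbitrarily small, so v
   approaches its average uniformly. *)

(** * Joint continuity and attained maxima *)

(** Continuity is required on the whole plane, negative times included, so that rectangles need no
    care at the edge [t = 0]. Functions on the cylinder are brought into this form by composing time
    with [Rmax 0]. *)
Definition jointly_continuous (f : R -> R -> R) : Prop :=
  forall p : R * R, continuous (fun q : R * R => f (fst q) (snd q)) p.

Lemma jointly_continuous_uniform (f : R -> R -> R) (a b c d : R) (eps : posreal) :
  jointly_continuous f ->
  exists delta : posreal, forall x y u v,
    a <= x <= b -> c <= y <= d -> a <= u <= b -> c <= v <= d ->
    Rabs (u - x) < delta -> Rabs (v - y) < delta -> Rabs (f u v - f x y) < eps.
Proof.
  intros Hf. apply uniform_continuity_2d. intros x y _ _.
  apply continuity_2d_pt_filterlim. exact (Hf (x, y)).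
Qed.

Lemma jointly_continuous_comp (f : R -> R -> R) (g h : R * R -> R) (p : R * R) :
  jointly_continuous f -> continuous g p -> continuous h p ->
  continuous (fun q => f (g q) (h q)) p.
Proof.
  intros Hf Hg Hh. apply (continuous_comp_2 g h f); auto.
Qed.

Lemma jointly_continuous_l (f : R -> R -> R) (t x : R) :
  jointly_continuous f -> continuous (fun y => f y t) x.
Proof.
  intros Hf. apply (continuous_comp_2 (fun y => y) (fun _ => t) f).
  - apply continuous_id.
  - apply continuous_const.
  - apply Hf.
Qed.

Lemma jointly_continuous_of_r (h : R -> R) :
  (forall t, continuous h t) -> jointly_continuous (fun _ t => h t).
Proof.
  intros Hh p. apply (continuous_comp snd h).
  - apply continuous_snd.
  - apply Hh.
Qed.

Lemma jointly_continuous_of_l (h : R -> R) :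
  (forall x, continuous h x) -> jointly_continuous (fun x _ => h x).
Proof.
  intros Hh p. apply (continuous_comp fst h).
  - apply continuous_fst.
  - apply Hh.
Qed.

Lemma jointly_continuous_plus (f g : R -> R -> R) :
  jointly_continuous f -> jointly_continuous g ->
  jointly_continuous (fun x t => f x t + g x t).
Proof. intros Hf Hg p. apply (continuous_plus _ _ p (Hf p) (Hg p)). Qed.

Lemma jointly_continuous_mult (f g : R -> R -> R) :
  jointly_continuous f -> jointly_continuous g ->
  jointly_continuous (fun x t => f x t * g x t).
Proof. intros Hf Hg p. apply (continuous_mult _ _ p (Hf p) (Hg p)). Qed.

Lemma jointly_continuous_scal (a : R) (f : R -> R -> R) :
  jointly_continuous f -> jointly_continuous (fun x t => a * f x t).
Proof.
  intros Hf. apply (jointly_continuous_mult (fun _ _ => a)); [| exact Hf].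
  intros p. apply continuous_const.
Qed.

(** A relation rather than a function, so that it applies both to maxima obtained by choice and to
    [circle_max]. *)
Definition is_max (f : R -> R) (a b M : R) : Prop :=
  (forall y, a <= y <= b -> f y <= M) /\ exists y, a <= y <= b /\ f y = M.

Lemma continuous_is_max (f : R -> R) (a b : R) :
  a <= b -> (forall x, continuous f x) -> exists M, is_max f a b M.
Proof.
  intros Hab Hf.
  destruct (continuity_ab_maj f a b Hab) as [x [H1 H2]].
  - intros c _. apply continuity_pt_filterlim. apply Hf.
  - exists (f x). split; eauto.
Qed.

(** Each slice is evaluated at the maximiser of the other one; uniform continuity on a strip of
    times bounds both differences by [eps]. *)
Lemma is_max_continuous (f : R -> R -> R) (S : R -> R) (a b : R) :
  jointly_continuous f -> (forall t, is_max (fun y => f y t) a b (S t)) ->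
  forall t, continuous S t.
Proof.
  intros Hf HS t. apply filterlim_locally. intros eps.
  destruct (jointly_continuous_uniform f a b (t - 1) (t + 1) eps Hf) as [d Hd].
  exists (mkposreal (Rmin d 1) (Rmin_pos _ _ (cond_pos d) Rlt_0_1)).
  intros s Hs. change (Rabs (s - t) < Rmin d 1) in Hs.
  change (Rabs (S s - S t) < eps).
  assert (Hs1 : Rabs (s - t) < d) by (eapply Rlt_le_trans; [apply Hs | apply Rmin_l]).
  assert (Hs2 : Rabs (s - t) < 1) by (eapply Rlt_le_trans; [apply Hs | apply Rmin_r]).
  apply Rabs_def2 in Hs2.
  assert (Hy : forall y, a <= y <= b -> Rabs (f y s - f y t) < eps).
  { intros y Hy. apply Hd; try lra.
    rewrite Rminus_diag, Rabs_R0. apply cond_pos. }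
  destruct (HS s) as [Ms [ys [Hys Es]]]. destruct (HS t) as [Mt [yt [Hyt Et]]].
  assert (A1 := Hy ys Hys). assert (A2 := Hy yt Hyt).
  apply Rabs_def2 in A1, A2. specialize (Ms yt Hyt). specialize (Mt ys Hys).
  apply Rabs_def1; lra.
Qed.

(** Maximise in space first: the slice maxima form a continuous function of time, which is then
    maximised in turn. *)
Lemma jointly_continuous_maximum (f : R -> R -> R) (a b c d : R) :
  a <= b -> c <= d -> jointly_continuous f ->
  exists x t, a <= x <= b /\ c <= t <= d /\
    forall y s, a <= y <= b -> c <= s <= d -> f y s <= f x t.
Proof.
  intros Hab Hcd Hf.
  destruct (functional_choice (fun t M => is_max (fun y => f y t) a b M)) as [S HS].
  { intros t. apply continuous_is_max; [exact Hab |].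
    intros x. apply jointly_continuous_l, Hf. }
  destruct (continuous_is_max S c d Hcd (is_max_continuous f S a b Hf HS))
    as [M [HM [t [Ht Et]]]].
  destruct (proj2 (HS t)) as [x [Hx Ex]].
  exists x, t. split; [exact Hx | split; [exact Ht |]].
  intros y s Hy Hs. rewrite Ex, Et.
  apply Rle_trans with (S s); [apply (proj1 (HS s)), Hy | apply HM, Hs].
Qed.

(** * Derivative tests and the parabolic maximum principle *)

(** Backward difference quotients at a maximum are nonnegative. The test looks only to the left
    because a maximum over [[0, T]] may sit at the final time. *)
Lemma derive_nonneg_left_max (f : R -> R) (a t D : R) :
  a < t -> is_derive f t D -> (forall s, a <= s <= t -> f s <= f t) -> 0 <= D.
Proof.
  intros Ha HD Hmax. apply is_derive_Reals in HD.
  destruct (Rle_or_lt 0 D) as [H | H]; [exact H | exfalso].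
  destruct (HD (- D)) as [d Hd]; [lra |].
  set (h := Rmin (d / 2) (t - a)).
  assert (Hd0 := cond_pos d).
  assert (Hh : 0 < h) by (apply Rmin_pos; lra).
  assert (h <= d / 2) by apply Rmin_l.
  assert (h <= t - a) by apply Rmin_r.
  assert (Hq := Hd (- h)).
  assert (Hq' : Rabs ((f (t + - h) - f t) / - h - D) < - D).
  { apply Hq; [lra |]. rewrite Rabs_Ropp, Rabs_pos_eq; lra. }
  apply Rabs_def2 in Hq'.
  assert (f (t + - h) <= f t) by (apply Hmax; lra).
  assert (0 <= (f (t + - h) - f t) / - h); [| lra].
  replace ((f (t + - h) - f t) / - h) with ((f t - f (t + - h)) / h) by (field; lra).
  apply Rle_mult_inv_pos; lra.
Qed.

(** The left-sided test, applied to [f] and to its reflection, gives [f1 x = 0]. If [D] were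
    positive, [f1] would be positive just to the right of [x], and the mean value theorem would make
    [f] exceed [f x] there. *)
Lemma second_derive_local_max (f f1 : R -> R) (x d D : R) :
  0 < d -> (forall y, is_derive f y (f1 y)) -> is_derive f1 x D ->
  (forall y, Rabs (y - x) < d -> f y <= f x) -> D <= 0.
Proof.
  intros Hd Hf Hf1 Hmax.
  assert (E : f1 x = 0).
  { apply Rle_antisym.
    - assert (Hr : is_derive (fun y => f (- y)) (- x) (- f1 x)).
      { evar_last.
        - apply (is_derive_comp f (fun y => - y) (- x) (f1 (- - x)) (- 1)); [apply Hf |].
          auto_derive; [trivial | ring].
        - rewrite Ropp_involutive. unfold scal; simpl; unfold mult; simpl. ring. }
      assert (0 <= - f1 x); [| lra].
      apply (derive_nonneg_left_max (fun y => f (- y)) (- x - d / 2) (- x)); [lra | exact Hr |].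
      intros s Hs. rewrite Ropp_involutive. apply Hmax. apply Rabs_def1; lra.
    - apply (derive_nonneg_left_max f (x - d / 2) x); [lra | apply Hf |].
      intros s Hs. apply Hmax. apply Rabs_def1; lra. }
  destruct (Rle_or_lt D 0) as [H | H]; [exact H | exfalso].
  apply is_derive_Reals in Hf1. destruct (Hf1 D H) as [e He].
  assert (He0 := cond_pos e).
  set (h := Rmin (d / 2) (e / 2)).
  assert (0 < h) by (apply Rmin_pos; lra).
  assert (h <= d / 2) by apply Rmin_l. assert (h <= e / 2) by apply Rmin_r.
  destruct (MVT_cor2 f f1 x (x + h)) as [c [Ec Hc]]; [lra | |].
  { intros y _. apply is_derive_Reals, Hf. }
  assert (Hq := He (c - x)). rewrite E in Hq.
  replace (x + (c - x)) with c in Hq by ring.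
  assert (Hq' : Rabs ((f1 c - 0) / (c - x) - D) < D).
  { apply Hq; [lra |]. rewrite Rabs_pos_eq; lra. }
  apply Rabs_def2 in Hq'.
  assert (0 < f1 c).
  { replace (f1 c) with ((f1 c - 0) / (c - x) * (c - x)) by (field; lra).
    apply Rmult_lt_0_compat; lra. }
  assert (f (x + h) <= f x) by (apply Hmax; apply Rabs_def1; lra).
  assert (0 < f1 c * (x + h - x)) by (apply Rmult_lt_0_compat; lra).
  lra.
Qed.

(* Subtracting [e * t] from a positive value of [u] leaves a positive maximum, at
   which the time derivative of [u] would have to be at least [e]. *)
Lemma parabolic_max_principle (u : R -> R -> R) (a b T : R) :
  a <= b -> jointly_continuous u ->
  (forall x, a <= x <= b -> u x 0 <= 0) ->
  (forall x t, a <= x <= b -> 0 < t <= T -> 0 < u x t ->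
     (forall y, a <= y <= b -> u y t <= u x t) ->
     exists D, is_derive (u x) t D /\ D <= 0) ->
  forall x t, a <= x <= b -> 0 <= t <= T -> u x t <= 0.
Proof.
  intros Hab Hc H0 Hmax x t Hx Ht.
  destruct (Rle_or_lt (u x t) 0) as [H | H]; [exact H | exfalso].
  (* Small enough that [e * T < u x t], so the perturbed function is still positive at [(x, t)]. *)
  set (e := u x t / (2 * (T + 1))).
  assert (He : 0 < e) by (apply Rdiv_lt_0_compat; lra).
  assert (Het : e * T < u x t).
  { assert (e * (2 * (T + 1)) = u x t) by (unfold e; field; lra). nra. }
  destruct (jointly_continuous_maximum (fun y s => u y s + - e * s) a b 0 T)
    as [y [s [Hy [Hs Hm]]]]; [lra | lra | |].
  { apply jointly_continuous_plus; [exact Hc |].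
    apply jointly_continuous_scal. intros p. apply continuous_snd. }
  simpl in Hm.
  assert (Hpos : 0 < u y s + - e * s).
  { apply Rlt_le_trans with (u x t + - e * t); [nra | apply Hm; lra]. }
  assert (Hes : 0 <= e * s) by (apply Rmult_le_pos; lra).
  assert (Hs0 : 0 < s).
  { destruct (Rle_lt_or_eq_dec 0 s (proj1 Hs)) as [L | L]; [exact L | exfalso].
    subst s. specialize (H0 y Hy). lra. }
  destruct (Hmax y s) as [D [HD1 HD2]]; [lra | lra | lra | |].
  { intros z Hz. specialize (Hm z s Hz Hs). lra. }
  assert (0 <= D + - e); [| lra].
  apply (derive_nonneg_left_max (fun r => u y r + - e * r) 0 s); [exact Hs0 | |].
  - apply (is_derive_plus (u y) (fun r => - e * r)); [exact HD1 |].
    auto_derive; [trivial | ring].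
  - intros r Hr. apply Hm; lra.
Qed.

(** * The heat equation with a sink, on an interval and on the circle *)

(** Here [g] is a sink: [u_t = u_xx - g] for positive times. The derivatives are existential
    witnesses, so that solutions combine directly through the rules for [is_derive]. *)
Definition heat_solution (g u : R -> R -> R) : Prop :=
  exists u1 u2 : R -> R -> R, forall x t, 0 < t ->
    is_derive (fun y => u y t) x (u1 x t) /\
    is_derive (fun y => u1 y t) x (u2 x t) /\
    is_derive (u x) t (u2 x t - g x t).

Lemma heat_solution_time_derive_at_max (g u : R -> R -> R) (x t d : R) :
  heat_solution g u -> 0 < t -> 0 < d ->
  (forall y, Rabs (y - x) < d -> u y t <= u x t) -> 0 <= g x t ->
  exists D, is_derive (u x) t D /\ D <= 0.
Proof.
  intros [u1 [u2 Hu]] Ht Hd Hmax Hg.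
  destruct (Hu x t Ht) as [_ [H2 H3]].
  exists (u2 x t - g x t). split; [exact H3 |].
  assert (u2 x t <= 0); [| lra].
  apply (second_derive_local_max (fun y => u y t) (fun y => u1 y t) x d); auto.
  intros y. apply (proj1 (Hu y t Ht)).
Qed.

(** A positive maximum cannot lie at an endpoint, hence is interior, where the derivative tests
    apply. *)
Lemma heat_max_principle_interval (g u : R -> R -> R) (a b T : R) :
  a <= b -> jointly_continuous u -> heat_solution g u ->
  (forall x, a <= x <= b -> u x 0 <= 0) ->
  (forall t, 0 < t -> u a t <= 0) -> (forall t, 0 < t -> u b t <= 0) ->
  (forall x t, 0 < t <= T -> 0 <= g x t) ->
  forall x t, a <= x <= b -> 0 <= t <= T -> u x t <= 0.
Proof.
  intros Hab Hc Hu H0 Ha Hb Hg. apply parabolic_max_principle; auto.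
  intros x t Hx Ht Hpos Hmax.
  assert (a < x < b).
  { split; apply Rnot_le_lt; intros L.
    - replace x with a in Hpos by lra. specialize (Ha t (proj1 Ht)). lra.
    - replace x with b in Hpos by lra. specialize (Hb t (proj1 Ht)). lra. }
  apply (heat_solution_time_derive_at_max g u x t (Rmin (x - a) (b - x))); auto.
  - apply Ht.
  - apply Rmin_pos; lra.
  - intros y Hy. apply Hmax. assert (Hl := Rmin_l (x - a) (b - x)).
    assert (Hr := Rmin_r (x - a) (b - x)). apply Rabs_def2 in Hy. lra.
Qed.

Lemma periodic_IZR (f : R -> R) (n : Z) (x : R) :
  periodic f -> f (x + IZR n * (2 * PI)) = f x.
Proof.
  intros Hf.
  assert (Hn : forall (m : nat) z, f (z + INR m * (2 * PI)) = f z).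
  { induction m as [| m IH]; intros z.
    - simpl. f_equal. ring.
    - rewrite S_INR. replace (z + (INR m + 1) * (2 * PI))
        with (z + INR m * (2 * PI) + 2 * PI) by ring.
      rewrite Hf. apply IH. }
  destruct (Z.le_gt_cases 0 n) as [H | H].
  - rewrite <- (Z2Nat.id n H), <- INR_IZR_INZ. apply Hn.
  - rewrite <- (Hn (Z.to_nat (- n)) (x + IZR n * (2 * PI))).
    rewrite INR_IZR_INZ, Z2Nat.id, opp_IZR by lia. f_equal. ring.
Qed.

Lemma period_translate (a x : R) :
  exists n : Z, a <= x + IZR n * (2 * PI) <= a + 2 * PI.
Proof.
  assert (HP := PI_RGT_0).
  destruct (archimed ((x - a) / (2 * PI))) as [H1 H2].
  set (n := up ((x - a) / (2 * PI))) in *.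
  assert (E : (x - a) / (2 * PI) * (2 * PI) = x - a) by (field; lra).
  exists (1 - n)%Z. rewrite minus_IZR. nra.
Qed.

(** The circle has no boundary: by periodicity a maximum over one period is a maximum over the whole
    line, even when it sits at [0] or [2 * PI]. *)
Lemma heat_max_principle_periodic (g u : R -> R -> R) (T : R) :
  jointly_continuous u -> (forall t, 0 < t -> periodic (fun x => u x t)) ->
  heat_solution g u ->
  (forall x, u x 0 <= 0) -> (forall x t, 0 < t <= T -> 0 <= g x t) ->
  forall x t, 0 <= x <= 2 * PI -> 0 <= t <= T -> u x t <= 0.
Proof.
  intros Hc Hper Hu H0 Hg. assert (HP := PI_RGT_0).
  apply parabolic_max_principle; auto; [lra |].
  intros x t Hx Ht Hpos Hmax.
  apply (heat_solution_time_derive_at_max g u x t 1); auto; [apply Ht | lra |].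
  intros y _. destruct (period_translate 0 y) as [n Hn].
  rewrite <- (periodic_IZR (fun z => u z t) n y (Hper t (proj1 Ht))).
  apply Hmax. lra.
Qed.

(** * Operations preserving the heat equation *)

Lemma heat_solution_plus (g h u w : R -> R -> R) :
  heat_solution g u -> heat_solution h w ->
  heat_solution (fun x t => g x t + h x t) (fun x t => u x t + w x t).
Proof.
  intros [u1 [u2 Hu]] [w1 [w2 Hw]].
  exists (fun x t => u1 x t + w1 x t), (fun x t => u2 x t + w2 x t).
  intros x t Ht.
  destruct (Hu x t Ht) as [A1 [A2 A3]]. destruct (Hw x t Ht) as [B1 [B2 B3]].
  split; [| split].
  - exact (is_derive_plus _ _ _ _ _ A1 B1).
  - exact (is_derive_plus _ _ _ _ _ A2 B2).
  - replace (u2 x t + w2 x t - (g x t + h x t))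
      with ((u2 x t - g x t) + (w2 x t - h x t)) by ring.
    exact (is_derive_plus _ _ _ _ _ A3 B3).
Qed.

Lemma heat_solution_scal (a : R) (g u : R -> R -> R) :
  heat_solution g u ->
  heat_solution (fun x t => a * g x t) (fun x t => a * u x t).
Proof.
  intros [u1 [u2 Hu]]. exists (fun x t => a * u1 x t), (fun x t => a * u2 x t).
  intros x t Ht. destruct (Hu x t Ht) as [A1 [A2 A3]].
  split; [| split].
  - exact (is_derive_scal _ _ a _ A1).
  - exact (is_derive_scal _ _ a _ A2).
  - replace (a * u2 x t - a * g x t) with (a * (u2 x t - g x t)) by ring.
    exact (is_derive_scal _ _ a _ A3).
Qed.

(** The case [s = 1] is a translation and [s = -1] a reflection; both leave the second space
    derivative unchanged, since it picks up the factor [s * s]. *)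
Lemma heat_solution_space (s a : R) (g u : R -> R -> R) :
  s * s = 1 -> heat_solution g u ->
  heat_solution (fun x t => g (s * x + a) t) (fun x t => u (s * x + a) t).
Proof.
  intros Hs [u1 [u2 Hu]].
  exists (fun x t => s * u1 (s * x + a) t), (fun x t => u2 (s * x + a) t).
  intros x t Ht. destruct (Hu (s * x + a) t Ht) as [A1 [A2 A3]].
  assert (D : is_derive (fun y => s * y + a) x s) by (auto_derive; [trivial | ring]).
  split; [| split].
  - exact (is_derive_comp (fun y => u y t) _ _ _ _ A1 D).
  - replace (u2 (s * x + a) t) with (s * (s * u2 (s * x + a) t))
      by (rewrite <- Rmult_assoc, Hs; ring).
    apply is_derive_scal. exact (is_derive_comp (fun y => u1 y t) _ _ _ _ A2 D).
  - exact A3.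
Qed.

(** Allows corrections depending on time alone to be added to a solution before the maximum
    principle is applied. *)
Lemma heat_solution_time (h h' : R -> R) :
  (forall t, 0 < t -> is_derive h t (h' t)) ->
  heat_solution (fun _ t => - h' t) (fun _ t => h t).
Proof.
  intros Hh. exists (fun _ _ => 0), (fun _ _ => 0). intros x t Ht.
  split; [| split].
  - exact (is_derive_const (h t) x).
  - exact (is_derive_const 0 x).
  - replace (0 - - h' t) with (h' t) by ring. apply Hh, Ht.
Qed.

Lemma heat_solution_time_shift (T : R) (g u : R -> R -> R) :
  0 <= T -> heat_solution g u ->
  heat_solution (fun x t => g x (t + T)) (fun x t => u x (t + T)).
Proof.
  intros HT [u1 [u2 Hu]].
  exists (fun x t => u1 x (t + T)), (fun x t => u2 x (t + T)).
  intros x t Ht. destruct (Hu x (t + T)) as [A1 [A2 A3]]; [lra |].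
  split; [exact A1 | split; [exact A2 |]].
  replace (u2 x (t + T) - g x (t + T)) with (1 * (u2 x (t + T) - g x (t + T))) by ring.
  apply (is_derive_comp (u x) (fun t => t + T)); [exact A3 |].
  auto_derive; [trivial | ring].
Qed.

(** * Integrals and averages over a period *)

Lemma ex_RInt_of_continuous (f : R -> R) (a b : R) :
  (forall x, continuous f x) -> ex_RInt f a b.
Proof. intros Hf. apply (ex_RInt_continuous (V := R_CompleteNormedModule)). auto. Qed.

Lemma RInt_Chasles_continuous (f : R -> R) (a b c : R) :
  (forall x, continuous f x) -> RInt f a b + RInt f b c = RInt f a c.
Proof.
  intros Hf. apply (RInt_Chasles f); apply ex_RInt_of_continuous, Hf.
Qed.

Lemma is_derive_RInt_continuous (f : R -> R) (a t : R) :
  (forall x, continuous f x) -> is_derive (RInt f a) t (f t).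
Proof.
  intros Hf. apply (is_derive_RInt f (RInt f a) a); [| apply Hf].
  exists (mkposreal 1 Rlt_0_1). intros y _.
  apply (RInt_correct f), ex_RInt_of_continuous, Hf.
Qed.

Lemma continuous_RInt_upper (f : R -> R) (a t : R) :
  (forall x, continuous f x) -> continuous (RInt f a) t.
Proof.
  intros Hf. apply (ex_derive_continuous (RInt f a)).
  exists (f t). apply is_derive_RInt_continuous, Hf.
Qed.

Lemma RInt_bounds (f : R -> R) (a b m M : R) :
  a <= b -> (forall x, continuous f x) ->
  (forall x, a <= x <= b -> m <= f x <= M) ->
  m * (b - a) <= RInt f a b <= M * (b - a).
Proof.
  intros Hab Hf HM.
  assert (Hc : forall z, RInt (fun _ => z) a b = z * (b - a)).
  { intros z. rewrite RInt_const. unfold scal; simpl; unfold mult; simpl. ring. }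
  rewrite <- (Hc m), <- (Hc M).
  split; (apply RInt_le; [exact Hab | | |]);
    try (apply ex_RInt_of_continuous; auto; intros; apply continuous_const);
    intros x Hx; apply HM; lra.
Qed.

Lemma RInt_translate (f : R -> R) (v a b : R) :
  (forall x, continuous f x) ->
  RInt (fun x => f (x + v)) a b = RInt f (a + v) (b + v).
Proof.
  intros Hf. rewrite <- (Rmult_1_l a) at 2. rewrite <- (Rmult_1_l b) at 2.
  rewrite <- (RInt_comp_lin f) by apply ex_RInt_of_continuous, Hf.
  apply RInt_ext. intros y _. rewrite 2 Rmult_1_l. reflexivity.
Qed.

(** The piece from [PI] to [x + 2 * PI] is moved back by one period onto the piece from [- PI] to
    [x]. *)
Lemma RInt_period (f : R -> R) (x : R) :
  periodic f -> (forall y, continuous f y) ->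
  RInt f x (x + 2 * PI) = RInt f (- PI) PI.
Proof.
  intros Hp Hf.
  assert (E : RInt f PI (x + 2 * PI) = RInt f (- PI) x).
  { replace PI with (- PI + 2 * PI) at 1 by ring.
    rewrite <- RInt_translate by exact Hf. apply RInt_ext. intros y _. apply Hp. }
  rewrite <- (RInt_Chasles_continuous f x PI), E by exact Hf.
  rewrite <- (RInt_Chasles_continuous f (- PI) x PI) by exact Hf.
  apply Rplus_comm.
Qed.

Lemma circle_average_bounds (f : R -> R) (x m M : R) :
  periodic f -> (forall y, continuous f y) ->
  (forall y, x <= y <= x + 2 * PI -> m <= f y <= M) ->
  m <= circle_average f <= M.
Proof.
  intros Hp Hf HM. assert (HP := PI_RGT_0).
  unfold circle_average. rewrite <- (RInt_period f x Hp Hf).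
  destruct (RInt_bounds f x (x + 2 * PI) m M) as [H1 H2]; [lra | exact Hf | exact HM |].
  assert (E : forall z, z = 1 / (2 * PI) * (z * (x + 2 * PI - x))) by (intros z; field; lra).
  assert (Hi : 0 <= 1 / (2 * PI)) by (apply Rlt_le, Rdiv_lt_0_compat; lra).
  split; [rewrite (E m) | rewrite (E M)]; apply Rmult_le_compat_l; auto.
Qed.

Lemma circle_average_scal (a : R) (f : R -> R) :
  (forall y, continuous f y) ->
  circle_average (fun x => a * f x) = a * circle_average f.
Proof.
  intros Hf. unfold circle_average.
  assert (E : RInt (fun x => a * f x) (- PI) PI = a * RInt f (- PI) PI)
    by apply (RInt_scal f (- PI) PI a), ex_RInt_of_continuous, Hf.
  rewrite E. ring.
Qed.

Lemma circle_average_minus (f g : R -> R) :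
  (forall y, continuous f y) -> (forall y, continuous g y) ->
  circle_average (fun x => f x - g x) = circle_average f - circle_average g.
Proof.
  intros Hf Hg. unfold circle_average.
  assert (E : RInt (fun x => f x - g x) (- PI) PI = RInt f (- PI) PI - RInt g (- PI) PI)
    by (apply (RInt_minus f g); apply ex_RInt_of_continuous; assumption).
  rewrite E. ring.
Qed.

Lemma circle_average_continuous (f : R -> R -> R) (t : R) :
  jointly_continuous f -> (forall s, periodic (fun x => f x s)) ->
  continuous (fun s => circle_average (fun x => f x s)) t.
Proof.
  intros Hf Hp. apply filterlim_locally. intros eps. assert (He := cond_pos eps).
  destruct (jointly_continuous_uniform f 0 (2 * PI) (t - 1) (t + 1)
    (pos_div_2 eps) Hf) as [d Hd].
  exists (mkposreal (Rmin d 1) (Rmin_pos _ _ (cond_pos d) Rlt_0_1)).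
  intros s Hs. change (Rabs (s - t) < Rmin d 1) in Hs.
  change (Rabs (circle_average (fun x => f x s) - circle_average (fun x => f x t)) < eps).
  assert (Hs1 : Rabs (s - t) < d) by (eapply Rlt_le_trans; [apply Hs | apply Rmin_l]).
  assert (Hs2 : Rabs (s - t) < 1) by (eapply Rlt_le_trans; [apply Hs | apply Rmin_r]).
  apply Rabs_def2 in Hs2.
  rewrite <- circle_average_minus by (intros; apply jointly_continuous_l, Hf).
  destruct (circle_average_bounds (fun x => f x s - f x t) 0 (- (eps / 2)) (eps / 2))
    as [H1 H2].
  - intros y. rewrite (Hp s y), (Hp t y). reflexivity.
  - intros y. apply (continuous_minus (fun x => f x s) (fun x => f x t));
      apply jointly_continuous_l, Hf.
  - intros y Hy. assert (A : Rabs (f y s - f y t) < eps / 2).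
    { apply Hd; try lra. rewrite Rminus_diag, Rabs_R0. apply cond_pos. }
    apply Rabs_def2 in A. lra.
  - apply Rabs_def1; lra.
Qed.

(** * Averages as limits of means of translates, and the mass balance *)

(** Times [h], this is the left Riemann sum of [f] over [[x, x + n h]]; as a function of [x] it is a
    finite sum of translates, so it inherits the heat equation. *)
Fixpoint translate_sum (h : R) (n : nat) (f : R -> R) (x : R) : R :=
  match n with
  | O => 0
  | S m => translate_sum h m f x + f (x + INR m * h)
  end.

Lemma translate_sum_RInt (h e : R) (n : nat) (f : R -> R) (x : R) :
  0 <= h -> (forall y, continuous f y) ->
  (forall y z, y <= z <= y + h -> Rabs (f z - f y) <= e) ->
  Rabs (h * translate_sum h n f x - RInt f x (x + INR n * h)) <= INR n * h * e.
Proof.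
  intros Hh Hf He. induction n as [| n IH].
  - simpl. rewrite Rmult_0_l, Rplus_0_r, RInt_point. unfold zero; simpl.
    rewrite Rmult_0_r, Rminus_0_r, Rabs_R0. lra.
  - rewrite S_INR. cbn [translate_sum]. set (y := x + INR n * h) in *.
    replace (x + (INR n + 1) * h) with (y + h) by (unfold y; ring).
    rewrite <- (RInt_Chasles_continuous f x y) by exact Hf.
    destruct (RInt_bounds f y (y + h) (f y - e) (f y + e)) as [H1 H2]; [lra | exact Hf | |].
    { intros z Hz. specialize (He y z Hz). apply Rabs_le_between in He. lra. }
    apply Rabs_le_between in IH. apply Rabs_le_between. split; nra.
Qed.

Lemma translate_sum_average (h e : R) (n : nat) (f : R -> R) (x : R) :
  0 <= h -> INR n * h = 2 * PI -> periodic f -> (forall y, continuous f y) ->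
  (forall y z, y <= z <= y + h -> Rabs (f z - f y) <= e) ->
  Rabs (h / (2 * PI) * translate_sum h n f x - circle_average f) <= e.
Proof.
  intros Hh Hn Hp Hf He. assert (HP := PI_RGT_0).
  assert (A := translate_sum_RInt h e n f x Hh Hf He).
  rewrite Hn, RInt_period in A by assumption. unfold circle_average.
  replace (h / (2 * PI) * translate_sum h n f x - 1 / (2 * PI) * RInt f (- PI) PI)
    with (1 / (2 * PI) * (h * translate_sum h n f x - RInt f (- PI) PI)) by (field; lra).
  assert (Hi : 0 < 1 / (2 * PI)) by (apply Rdiv_lt_0_compat; lra).
  rewrite Rabs_mult, (Rabs_pos_eq (1 / (2 * PI))) by lra.
  replace e with (1 / (2 * PI) * (2 * PI * e)) by (field; lra).
  apply Rmult_le_compat_l; lra.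
Qed.

Lemma jointly_continuous_translate_sum (h : R) (n : nat) (f : R -> R -> R) :
  jointly_continuous f ->
  jointly_continuous (fun x t => translate_sum h n (fun y => f y t) x).
Proof.
  intros Hf. induction n as [| n IH]; cbn [translate_sum].
  - intros p. apply continuous_const.
  - apply jointly_continuous_plus; [exact IH |].
    intros p. apply (jointly_continuous_comp f (fun q => fst q + INR n * h) snd p Hf).
    + apply (continuous_plus fst (fun _ => INR n * h) p).
      * apply continuous_fst.
      * apply continuous_const.
    + apply continuous_snd.
Qed.

Lemma heat_solution_translate_sum (h : R) (n : nat) (g u : R -> R -> R) :
  heat_solution g u ->
  heat_solution (fun x t => translate_sum h n (fun y => g y t) x)
                (fun x t => translate_sum h n (fun y => u y t) x).
Proof.
  intros Hu. induction n as [| n IH]; cbn [translate_sum].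
  - exists (fun _ _ => 0), (fun _ _ => 0). intros x t _.
    replace (0 - 0) with 0 by ring.
    split; [| split]; apply (is_derive_const 0).
  - apply heat_solution_plus; [exact IH |].
    destruct Hu as [u1 [u2 Hu]].
    exists (fun x t => u1 (x + INR n * h) t), (fun x t => u2 (x + INR n * h) t).
    intros x t Ht. destruct (Hu (x + INR n * h) t Ht) as [A1 [A2 A3]].
    assert (D : is_derive (fun y => y + INR n * h) x 1) by (auto_derive; [trivial | ring]).
    split; [| split; [| exact A3]].
    + replace (u1 (x + INR n * h) t) with (1 * u1 (x + INR n * h) t) by ring.
      exact (is_derive_comp (fun y => u y t) _ _ _ _ A1 D).
    + replace (u2 (x + INR n * h) t) with (1 * u2 (x + INR n * h) t) by ring.
      exact (is_derive_comp (fun y => u1 y t) _ _ _ _ A2 D).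
Qed.

Lemma translate_sum_periodic (h : R) (n : nat) (f : R -> R) :
  periodic f -> periodic (translate_sum h n f).
Proof.
  intros Hf x. induction n as [| n IH]; cbn [translate_sum]; [reflexivity |].
  rewrite IH. f_equal.
  replace (x + 2 * PI + INR n * h) with (x + INR n * h + 2 * PI) by ring. apply Hf.
Qed.

Lemma periodic_uniform_modulus (f : R -> R -> R) (T e : R) :
  jointly_continuous f -> (forall t, periodic (fun x => f x t)) -> 0 < e ->
  exists d, 0 < d /\ forall y z t, 0 <= t <= T -> y <= z <= y + d ->
    Rabs (f z t - f y t) <= e.
Proof.
  intros Hf Hp He.
  (* Once [y] is moved into [[0, 2 * PI]], the point [z] may overshoot the period by at most 1. *)
  destruct (jointly_continuous_uniform f 0 (2 * PI + 1) 0 T (mkposreal e He) Hf)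
    as [d Hd]. assert (Hd0 := cond_pos d).
  assert (H1 := Rmin_l (d / 2) 1). assert (H2 := Rmin_r (d / 2) 1).
  exists (Rmin (d / 2) 1). split; [apply Rmin_pos; lra |].
  intros y z t Ht Hyz. destruct (period_translate 0 y) as [n Hn].
  rewrite <- (periodic_IZR _ n y (Hp t)), <- (periodic_IZR _ n z (Hp t)).
  apply Rlt_le, Hd; try lra; simpl.
  - apply Rabs_def1; lra.
  - rewrite Rminus_diag, Rabs_R0. exact Hd0.
Qed.

(* The mean of [n] equally spaced translates of [u] is almost independent of
   [x], so the maximum principle compares it with the solution of an ordinary
   differential equation; no differentiation under the integral sign is needed. *)
Lemma circle_average_heat (g u : R -> R -> R) (T : R) :
  jointly_continuous u -> jointly_continuous g ->
  (forall t, periodic (fun x => u x t)) -> (forall t, periodic (fun x => g x t)) ->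
  heat_solution g u -> 0 <= T ->
  circle_average (fun x => u x T) = circle_average (fun x => u x 0) -
    RInt (fun s => circle_average (fun x => g x s)) 0 T.
Proof.
  intros Hcu Hcg Hpu Hpg Hu HT. assert (HP := PI_RGT_0).
  set (b := fun s => circle_average (fun x => g x s)).
  assert (Hb : forall s, continuous b s) by (intros s; apply circle_average_continuous; auto).
  set (A := circle_average (fun x => u x 0)).
  set (B := circle_average (fun x => u x T)).
  (* The error collects [e] at time 0, [e] at time [T], where means replace averages, and [e * T]
     from the sink. *)
  assert (Heta : forall e, 0 < e -> Rabs (B - (A - RInt b 0 T)) <= e * (2 + T)).
  { intros e He.
    destruct (periodic_uniform_modulus u T e) as [d1 [Hd1 Hm1]]; auto.
    destruct (periodic_uniform_modulus g T e) as [d2 [Hd2 Hm2]]; auto.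
    assert (Hl := Rmin_l d1 d2). assert (Hr := Rmin_r d1 d2).
    assert (Hd : 0 < Rmin d1 d2) by (apply Rmin_pos; lra).
    destruct (archimed_cor1 (Rmin d1 d2 / (2 * PI))) as [n [Hn Hn0]].
    { apply Rdiv_lt_0_compat; lra. }
    assert (Hn1 : 0 < INR n) by (apply lt_0_INR; lia).
    set (h := 2 * PI / INR n).
    assert (Hh : INR n * h = 2 * PI) by (unfold h; field; lra).
    assert (Hh0 : 0 < h) by (apply Rdiv_lt_0_compat; lra).
    assert (Hhd : h < Rmin d1 d2).
    { replace (Rmin d1 d2) with (2 * PI * (Rmin d1 d2 / (2 * PI))) by (field; lra).
      unfold h, Rdiv at 1. apply Rmult_lt_compat_l; lra. }
    set (mean := fun (f : R -> R -> R) x t =>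
      h / (2 * PI) * translate_sum h n (fun y => f y t) x).
    assert (Hmu : forall x t, 0 <= t <= T ->
        Rabs (mean u x t - circle_average (fun y => u y t)) <= e).
    { intros x t Ht. apply translate_sum_average; auto; [lra | |].
      - intros y. apply jointly_continuous_l, Hcu.
      - intros y z Hyz. apply Hm1; lra. }
    assert (Hmg : forall x t, 0 <= t <= T -> Rabs (mean g x t - b t) <= e).
    { intros x t Ht. apply translate_sum_average; auto; [lra | |].
      - intros y. apply jointly_continuous_l, Hcg.
      - intros y z Hyz. apply Hm2; lra. }
    (* The two signs give the upper and the lower bound. *)
    assert (Hs : forall s, s = 1 \/ s = -1 ->
        s * mean u 0 T + (s * (RInt b 0 T - A) - e - e * T) <= 0).
    { intros s Hs.
      (* The term [- e] makes the initial value nonpositive, and [- e * t] makes the total sink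
         [s * (mean g - b) + e] nonnegative. *)
      set (q := fun t => s * (RInt b 0 t - A) - e - e * t).
      set (q' := fun t => s * b t - e).
      assert (Hq : forall t, is_derive q t (q' t)).
      { intros t. unfold q, q'.
        auto_derive; [| ring]. split; [apply ex_RInt_of_continuous, Hb | split; [| trivial]].
        apply filter_forall. intros r. apply continuity_pt_filterlim, Hb. }
      apply (heat_max_principle_periodic
        (fun x t => s * mean g x t + - q' t) (fun x t => s * mean u x t + q t) T).
      - apply jointly_continuous_plus.
        + do 2 apply jointly_continuous_scal. apply jointly_continuous_translate_sum, Hcu.
        + apply jointly_continuous_of_r. intros t. apply (ex_derive_continuous q).
          exists (q' t). apply Hq.
      - intros t _ x. unfold mean. rewrite (translate_sum_periodic h n _ (Hpu t) x).
        reflexivity.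
      - apply heat_solution_plus.
        + do 2 apply heat_solution_scal. apply heat_solution_translate_sum, Hu.
        + apply heat_solution_time. intros t _. apply Hq.
      - intros x. unfold q. rewrite RInt_point. unfold zero; simpl.
        specialize (Hmu x 0). fold A in Hmu.
        assert (C : Rabs (mean u x 0 - A) <= e) by (apply Hmu; lra).
        apply Rabs_le_between in C. destruct Hs; subst s; lra.
      - intros x t Ht. unfold q'.
        assert (C : Rabs (mean g x t - b t) <= e) by (apply Hmg; lra).
        apply Rabs_le_between in C. destruct Hs; subst s; lra.
      - lra.
      - lra. }
    assert (C : Rabs (mean u 0 T - B) <= e) by (apply Hmu; lra).
    apply Rabs_le_between in C.
    assert (S1 := Hs 1 (or_introl eq_refl)). assert (S2 := Hs (-1) (or_intror eq_refl)).
    apply Rabs_le_between. split; nra. }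
  apply Rminus_diag_uniq. apply Rabs_eq_0. apply Rle_antisym; [| apply Rabs_pos].
  apply le_epsilon. intros e He. rewrite Rplus_0_l.
  replace e with (e / (2 + T) * (2 + T)) by (field; lra).
  apply Heta. apply Rdiv_lt_0_compat; lra.
Qed.

(** * Decay of the oscillation *)

(** Both terms are nonnegative and their squares sum to 1, so the square of the sum is at least
    1. *)
Lemma sin_cos_half_sum (x : R) :
  0 <= x <= PI -> 1 <= sin (x / 2) + cos (x / 2) <= 2.
Proof.
  intros Hx. assert (Hs := sin_ge_0 (x / 2)). assert (Hc := cos_ge_0 (x / 2)).
  assert (H := sin2_cos2 (x / 2)). unfold Rsqr in H.
  assert (HS := SIN_bound (x / 2)). assert (HC := COS_bound (x / 2)).
  assert (0 <= sin (x / 2)) by (apply Hs; lra).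
  assert (0 <= cos (x / 2)) by (apply Hc; lra).
  split; nra.
Qed.

(* The difference of [u] and its reflection in [p] vanishes at [0] and [PI]; the
   barrier [e^(-t/4) (sin (x/2) + cos (x/2))] is a solution of the heat equation
   that is positive on [0, PI]. *)
Lemma heat_oscillation (g u : R -> R -> R) (m : R -> R) (K p x t : R) :
  jointly_continuous u -> (forall t, periodic (fun x => u x t)) ->
  heat_solution g u -> (forall t, continuous m t) ->
  (forall x t, 0 < t -> 0 <= g x t <= m t) -> (forall x, 0 <= u x 0 <= K) ->
  0 <= x <= PI -> 0 <= t ->
  u (p + x) t - u (p - x) t <= 2 * K * exp (- t / 4) + RInt m 0 t.
Proof.
  intros Hcu Hpu Hu Hm Hg H0 Hx Ht. assert (HP := PI_RGT_0).
  assert (HK : 0 <= K) by (specialize (H0 0); lra).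
  set (B := fun x t => exp (- t / 4) * (sin (x / 2) + cos (x / 2))).
  (* The arguments are written as [s * x + p] with [s] equal to 1 or -1 to fit
     [heat_solution_space]. *)
  set (z := fun x t =>
    u (1 * x + p) t + -1 * u (-1 * x + p) t + (- K * B x t + - RInt m 0 t)).
  assert (Hm0 : forall t, 0 <= t -> 0 <= RInt m 0 t).
  { intros s Hs. destruct (Req_dec s 0) as [-> | Hs0].
    - rewrite RInt_point. apply Rle_refl.
    - apply RInt_ge_0; [exact Hs | apply ex_RInt_of_continuous, Hm |].
      intros r Hr. specialize (Hg 0 r (proj1 Hr)). lra. }
  assert (HB : forall x t, 0 <= x <= PI -> 0 <= K * B x t <= 2 * K * exp (- t / 4)).
  { intros y s Hy. unfold B. assert (S := sin_cos_half_sum y Hy).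
    assert (E := exp_pos (- s / 4)). assert (0 <= K * exp (- s / 4)) by nra. split; nra. }
  assert (Hz : z x t <= 0).
  { apply (heat_max_principle_interval
      (fun x t => g (1 * x + p) t + -1 * g (-1 * x + p) t + (- K * 0 + - - m t)) z 0 PI t).
    - lra.
    - assert (Haff : forall s, jointly_continuous (fun x t => u (s * x + p) t)).
      { intros s q. apply (jointly_continuous_comp u (fun q => s * fst q + p) snd q Hcu).
        - apply (continuous_plus (fun q => s * fst q) (fun _ => p) q).
          + apply (continuous_scal_r s fst q). apply continuous_fst.
          + apply continuous_const.
        - apply continuous_snd. }
      apply jointly_continuous_plus; apply jointly_continuous_plus.
      + apply Haff.
      + apply jointly_continuous_scal, Haff.
      + apply jointly_continuous_scal. apply jointly_continuous_mult.
        * apply jointly_continuous_of_r. intros s.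
          apply (ex_derive_continuous (fun t => exp (- t / 4))). auto_derive. trivial.
        * apply jointly_continuous_of_l. intros s.
          apply (ex_derive_continuous (fun x => sin (x / 2) + cos (x / 2))).
          auto_derive. trivial.
      + apply (jointly_continuous_of_r (fun t => - RInt m 0 t)). intros s.
        apply (continuous_opp (RInt m 0)). apply continuous_RInt_upper, Hm.
    - apply heat_solution_plus; apply heat_solution_plus.
      + apply heat_solution_space; [ring | exact Hu].
      + apply heat_solution_scal, heat_solution_space; [ring | exact Hu].
      + apply (heat_solution_scal (- K) (fun _ _ => 0) B).
        exists (fun x t => exp (- t / 4) * (cos (x / 2) / 2 - sin (x / 2) / 2)),
          (fun x t => - B x t / 4).
        intros y s _. unfold B.
        split; [| split]; (auto_derive; [trivial | unfold Rdiv; field]).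
      + apply (heat_solution_time (fun t => - RInt m 0 t) (fun t => - m t)).
        intros s _. apply (is_derive_opp (RInt m 0)).
        apply is_derive_RInt_continuous, Hm.
    (* At time 0 the difference of the two values is at most [K], while the barrier is at least
       1. *)
    - intros y Hy. unfold z, B. rewrite RInt_point. unfold zero; simpl.
      replace (- 0 / 4) with 0 by field. rewrite exp_0.
      assert (S := sin_cos_half_sum y Hy).
      assert (A1 := H0 (1 * y + p)). assert (A2 := H0 (-1 * y + p)). nra.
    (* At [0] the two arguments coincide; at [PI] they differ by a full period. *)
    - intros s Hs. unfold z. specialize (HB 0 s). specialize (Hm0 s).
      replace (1 * 0 + p) with (-1 * 0 + p) by ring. lra.
    - intros s Hs. unfold z. specialize (HB PI s). specialize (Hm0 s).
      replace (1 * PI + p) with (-1 * PI + p + 2 * PI) by ring.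
      rewrite (Hpu s (-1 * PI + p)). lra.
    (* The two sink values lie in [[0, m s]], so adding [m s] to their difference gives a
       nonnegative total. *)
    - intros y s Hs. assert (A1 := Hg (1 * y + p) s (proj1 Hs)).
      assert (A2 := Hg (-1 * y + p) s (proj1 Hs)). lra.
    - exact Hx.
    - lra. }
  unfold z in Hz. specialize (HB x t Hx).
  replace (1 * x + p) with (p + x) in Hz by ring.
  replace (-1 * x + p) with (p - x) in Hz by ring. lra.
Qed.

(** Two points at distance at most [2 * PI] are mirror images in their midpoint, so the reflection
    estimate bounds the difference of any two values, hence the distance of each value to the
    average. *)
Lemma heat_near_average (g u : R -> R -> R) (m : R -> R) (K x t : R) :
  jointly_continuous u -> (forall t, periodic (fun x => u x t)) ->
  heat_solution g u -> (forall t, continuous m t) ->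
  (forall x t, 0 < t -> 0 <= g x t <= m t) -> (forall x, 0 <= u x 0 <= K) ->
  0 <= t ->
  Rabs (u x t - circle_average (fun y => u y t)) <= 2 * K * exp (- t / 4) + RInt m 0 t.
Proof.
  intros Hcu Hpu Hu Hm Hg H0 Ht.
  set (E := 2 * K * exp (- t / 4) + RInt m 0 t).
  assert (Hosc : forall y z, y <= z <= y + 2 * PI -> u z t - u y t <= E).
  { intros y z Hyz.
    replace z with ((y + z) / 2 + (z - y) / 2) at 1 by field.
    replace y with ((y + z) / 2 - (z - y) / 2) at 3 by field.
    apply (heat_oscillation g); auto. lra. }
  assert (Hosc' : forall y z, u z t - u y t <= E).
  { intros y z. destruct (period_translate y z) as [n Hn].
    rewrite <- (periodic_IZR _ n z (Hpu t)). apply Hosc, Hn. }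
  destruct (circle_average_bounds (fun y => u y t) 0 (u x t - E) (u x t + E)).
  - apply Hpu.
  - intros y. apply jointly_continuous_l, Hcu.
  - intros y _. assert (A1 := Hosc' x y). assert (A2 := Hosc' y x). lra.
  - apply Rabs_le_between. lra.
Qed.

(** * Monotone limits and improper integrals *)

Lemma nondecreasing_bounded_limit (F : R -> R) (B : R) :
  (forall s t, 0 <= s <= t -> F s <= F t) -> (forall t, 0 <= t -> F t <= B) ->
  exists l, (forall t, 0 <= t -> F t <= l) /\
    forall e, 0 < e -> exists T, 0 <= T /\ forall t, T <= t -> l - e < F t.
Proof.
  intros Hmono HB.
  destruct (completeness (fun y => exists t, 0 <= t /\ y = F t)) as [l [Hub Hlub]].
  - exists B. intros y [t [Ht ->]]. apply HB, Ht.
  - exists (F 0), 0. split; [lra | reflexivity].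
  - exists l. split.
    + intros t Ht. apply Hub. exists t. split; [exact Ht | reflexivity].
    + intros e He. destruct (Classical_Prop.classic (exists T, 0 <= T /\ l - e < F T))
        as [[T [HT HF]] | H].
      * exists T. split; [exact HT |]. intros t Ht.
        apply Rlt_le_trans with (F T); [exact HF | apply Hmono; lra].
      * exfalso. assert (l <= l - e); [| lra]. apply Hlub.
        intros y [t [Ht ->]]. apply Rnot_lt_le. intros L. apply H. eauto.
Qed.

Lemma RInt_nondecreasing (f : R -> R) (s t : R) :
  (forall x, continuous f x) -> (forall x, 0 <= x -> 0 <= f x) ->
  0 <= s <= t -> RInt f 0 s <= RInt f 0 t.
Proof.
  intros Hf H0 Hst. rewrite <- (RInt_Chasles_continuous f 0 s t) by exact Hf.
  assert (0 <= RInt f s t); [| lra].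
  apply RInt_ge_0; [lra | apply ex_RInt_of_continuous, Hf |].
  intros x Hx. apply H0. lra.
Qed.

Lemma is_RInt_gen_limit (f : R -> R) (l : R) :
  (forall t, 0 <= t -> ex_RInt f 0 t) ->
  (forall e, 0 < e -> exists T, forall t, T <= t -> Rabs (RInt f 0 t - l) < e) ->
  is_RInt_gen f (at_point 0) (Rbar_locally p_infty) l.
Proof.
  intros Hex Hlim P [e HP]. destruct (Hlim e (cond_pos e)) as [T HT].
  apply (Filter_prod _ _ _ (fun a => a = 0) (fun t => Rmax 0 T < t)).
  - reflexivity.
  - exists (Rmax 0 T). auto.
  - intros a t -> Ht. assert (H1 := Rmax_l 0 T). assert (H2 := Rmax_r 0 T).
    exists (RInt f 0 t). split.
    + apply (RInt_correct f), Hex. lra.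
    + apply HP. apply HT. lra.
Qed.

(** * Extension to negative times and reduction to the heat equation *)

Lemma continuous_Rmax_0 (t : R) : continuous (Rmax 0) t.
Proof.
  apply filterlim_locally. intros e. exists e. intros s Hs.
  change (Rabs (s - t) < e) in Hs. change (Rabs (Rmax 0 s - Rmax 0 t) < e).
  apply Rabs_def2 in Hs. apply Rabs_def1; unfold Rmax;
    destruct (Rle_dec 0 s), (Rle_dec 0 t); lra.
Qed.

(** The extension factors through the continuous retraction [phi] of the plane onto the half-plane
    of nonnegative times, where continuity within the domain is enough. *)
Lemma continuous_on_cylinder_extend (f : R -> R -> R) :
  continuous_on_cylinder f -> jointly_continuous (fun x t => f x (Rmax 0 t)).
Proof.
  intros [_ Hf] p.
  set (phi := fun q : R * R => (fst q, Rmax 0 (snd q))).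
  assert (Hphi : continuous phi p).
  { apply (continuous_comp_2 fst (fun q => Rmax 0 (snd q)) pair).
    - apply continuous_fst.
    - apply (continuous_comp snd (Rmax 0)); [apply continuous_snd | apply continuous_Rmax_0].
    - apply (continuous_ext (fun z => z)); [intros [a b]; reflexivity | apply continuous_id]. }
  assert (HD : forall q, 0 <= snd (phi q)) by (intros q; apply Rmax_l).
  intros P HP. specialize (Hf (phi p) (HD p) P HP).
  apply (filter_imp (F := locally p)) with (2 := Hphi _ Hf). intros q Hq. apply Hq, HD.
Qed.

Lemma circle_average_ext (f g : R -> R) :
  (forall x, f x = g x) -> circle_average f = circle_average g.
Proof.
  intros H. unfold circle_average. f_equal. apply RInt_ext. intros x _. apply H.
Qed.

Lemma circle_max_is_max (f : R -> R) :
  periodic f -> (forall x, continuous f x) -> is_max f 0 (2 * PI) (circle_max f).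
Proof.
  intros Hp Hf. assert (HP := PI_RGT_0).
  destruct (continuous_is_max f 0 (2 * PI)) as [M [HM [y [Hy Ey]]]]; [lra | exact Hf |].
  replace (circle_max f) with M; [split; eauto |].
  unfold circle_max. rewrite (is_lub_Rbar_unique _ (Finite M)); [reflexivity |].
  split.
  - intros r [x ->]. destruct (period_translate 0 x) as [n Hn].
    rewrite <- (periodic_IZR f n x Hp). apply HM. lra.
  - intros b Hb. apply Hb. exists y. congruence.
Qed.

(** The factor [exp (- A0 * t)] cancels the growth term [A0 * k]; near any positive time the
    extension by [Rmax 0] agrees with the original function. *)
Lemma classical_solution_heat (A0 : R) (c k : R -> R -> R) (k0 : R -> R) :
  classical_solution A0 c k0 k ->
  heat_solution (fun x t => exp (- A0 * t) * c x (Rmax 0 t))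
                (fun x t => exp (- A0 * t) * k x (Rmax 0 t)).
Proof.
  intros [_ [HC2 [Hdt [Heq _]]]].
  exists (fun x t => exp (- A0 * t) * Derive (fun y => k y t) x),
         (fun x t => exp (- A0 * t) * Derive (Derive (fun y => k y t)) x).
  intros x t Ht. rewrite Rmax_right by lra. split; [| split].
  - apply is_derive_scal. apply Derive_correct, (HC2 t Ht x).
  - apply is_derive_scal. apply Derive_correct, (HC2 t Ht x).
  - apply (is_derive_ext_loc (fun s => exp (- A0 * s) * k x s)).
    + exists (mkposreal t Ht). intros s Hs. change (Rabs (s - t) < t) in Hs.
      apply Rabs_def2 in Hs. rewrite Rmax_right by lra. reflexivity.
    + assert (D : Derive (fun s => k x s) t =
        Derive (Derive (fun y => k y t)) x + A0 * k x t - c x t) by (apply Heq; exact Ht).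
      auto_derive; [apply Hdt, Ht |].
      rewrite D. ring.
Qed.

(** * Uniform convergence of the rescaled solution *)

Theorem proposition6 :
  forall (A0 : R) (k0 : R -> R) (c k : R -> R -> R),
    0 <= A0 ->
    periodic k0 -> (forall x, continuous k0 x) -> (forall x, 0 <= k0 x) ->
    continuous_on_cylinder c -> (forall x t, 0 <= t -> 0 <= c x t) ->
    (forall x t, 0 <= t ->
       k0 x >= RInt (fun s => exp (- A0 * s) * circle_max (fun y => c y s)) 0 t) ->
    classical_solution A0 c k0 k ->
    (forall x t, 0 <= t -> 0 <= k x t) ->
    (exists M, forall t, 0 <= t -> Rabs (circle_average (fun x => c x t)) <= M) ->
    ex_RInt_gen (fun s => exp (- A0 * s) * circle_average (fun x => c x s))
      (at_point 0) (Rbar_locally p_infty) /\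
    uniform_limit_at_infinity
      (fun x t => k x t * exp (- A0 * t))
      (circle_average k0 -
       RInt_gen (fun s => exp (- A0 * s) * circle_average (fun x => c x s))
         (at_point 0) (Rbar_locally p_infty)).
Proof.
  intros A0 k0 c k _ _ _ _ Hc Hc0 Hk0c Hk Hk0 _. assert (HP := PI_RGT_0).
  assert (Hheat := classical_solution_heat A0 c k k0 Hk).
  destruct Hk as [Hk [_ [_ [_ Hinit]]]].
  set (g := fun x t => exp (- A0 * t) * c x (Rmax 0 t)) in *.
  set (v := fun x t => exp (- A0 * t) * k x (Rmax 0 t)) in *.
  set (m := fun t => exp (- A0 * t) * circle_max (fun x => c x (Rmax 0 t))).
  set (b := fun t => circle_average (fun x => g x t)).
  assert (Hexp : forall t, continuous (fun s => exp (- A0 * s)) t).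
  { intros t. apply (ex_derive_continuous (fun s => exp (- A0 * s))).
    auto_derive. trivial. }
  assert (Hcc := continuous_on_cylinder_extend c Hc).
  assert (Hcg : jointly_continuous g).
  { apply jointly_continuous_mult; [apply jointly_continuous_of_r, Hexp | exact Hcc]. }
  assert (Hcv : jointly_continuous v).
  { apply jointly_continuous_mult; [apply jointly_continuous_of_r, Hexp |].
    apply continuous_on_cylinder_extend, Hk. }
  assert (Hpc : forall t, periodic (fun x => c x (Rmax 0 t))).
  { intros t. apply (proj1 Hc), Rmax_l. }
  assert (Hpg : forall t, periodic (fun x => g x t)).
  { intros t x. unfold g. rewrite (Hpc t x). reflexivity. }
  assert (Hpv : forall t, periodic (fun x => v x t)).
  { intros t x. unfold v. rewrite (proj1 Hk (Rmax 0 t) (Rmax_l 0 t) x). reflexivity. }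
  assert (Hmax : forall t, is_max (fun x => c x (Rmax 0 t)) 0 (2 * PI)
                             (circle_max (fun x => c x (Rmax 0 t)))).
  { intros t. apply circle_max_is_max; [apply Hpc |].
    intros x. apply (jointly_continuous_l (fun x t => c x (Rmax 0 t))), Hcc. }
  assert (Hm : forall t, continuous m t).
  { intros t. apply (continuous_mult (fun s => exp (- A0 * s))
      (fun s => circle_max (fun x => c x (Rmax 0 s)))); [apply Hexp |].
    apply (is_max_continuous _ _ _ _ Hcc Hmax). }
  assert (Hb : forall t, continuous b t).
  { intros t. apply circle_average_continuous; assumption. }
  assert (Hgm : forall x t, 0 <= g x t <= m t).
  { intros x t. assert (E := exp_pos (- A0 * t)). unfold g, m. split.
    - apply Rmult_le_pos; [lra | apply Hc0, Rmax_l].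
    - apply Rmult_le_compat_l; [lra |]. destruct (period_translate 0 x) as [n Hn].
      rewrite <- (periodic_IZR _ n x (Hpc t)). apply (proj1 (Hmax t)). lra. }
  assert (Hbm : forall t, 0 <= b t <= m t).
  { intros t. apply (circle_average_bounds (fun x => g x t) 0); [apply Hpg | |].
    - intros x. apply jointly_continuous_l, Hcg.
    - intros x _. apply Hgm. }
  (* The assumption on [k0], used at the single point 0, bounds the integral of [m] uniformly in
     time. *)
  assert (HmB : forall t, 0 <= t -> RInt m 0 t <= k0 0).
  { intros t Ht. apply Rge_le.
    replace (RInt m 0 t)
      with (RInt (fun s => exp (- A0 * s) * circle_max (fun y => c y s)) 0 t);
      [apply Hk0c, Ht |].
    apply RInt_ext. intros s Hs. rewrite Rmin_left in Hs by lra.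
    unfold m. rewrite Rmax_right by lra. reflexivity. }
  assert (Hm0 : forall t, 0 <= m t) by (intros t; specialize (Hbm t); lra).
  destruct (nondecreasing_bounded_limit (RInt m 0) (k0 0)) as [lm [Hlm Hlm']].
  { intros s t Hst. apply RInt_nondecreasing; auto. }
  { exact HmB. }
  destruct (nondecreasing_bounded_limit (RInt b 0) (k0 0)) as [lb [Hlb Hlb']].
  { intros s t Hst. apply RInt_nondecreasing; auto. intros r _. apply Hbm. }
  { intros t Ht. apply Rle_trans with (RInt m 0 t); [| apply HmB, Ht].
    apply RInt_le; [exact Ht | | |]; try (apply ex_RInt_of_continuous; assumption).
    intros s _. apply Hbm. }
  assert (Hphi : forall s, 0 <= s ->
    b s = exp (- A0 * s) * circle_average (fun x => c x s)).
  { intros s Hs. unfold b, g. rewrite Rmax_right by exact Hs.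
    apply (circle_average_scal (exp (- A0 * s)) (fun x => c x s)).
    intros y. replace s with (Rmax 0 s) by (apply Rmax_right, Hs).
    apply (jointly_continuous_l (fun x t => c x (Rmax 0 t))), Hcc. }
  assert (Hgen : is_RInt_gen (fun s => exp (- A0 * s) * circle_average (fun x => c x s))
                   (at_point 0) (Rbar_locally p_infty) lb).
  { apply is_RInt_gen_limit.
    - intros t Ht. apply (ex_RInt_ext b).
      + intros s Hs. rewrite Rmin_left in Hs by lra. apply Hphi. lra.
      + apply ex_RInt_of_continuous, Hb.
    - intros e He. destruct (Hlb' e He) as [T [HT0 HT]]. exists T. intros t Ht.
      rewrite <- (RInt_ext b).
      + specialize (HT t Ht). assert (A := Hlb t). apply Rabs_def1; lra.
      + intros s Hs. rewrite Rmin_left in Hs by lra. apply Hphi. lra. }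
  split; [exists lb; exact Hgen |].
  rewrite (is_RInt_gen_unique _ _ Hgen).
  intros P [eps HPeps]. assert (Heps := cond_pos eps).
  (* One third of [eps] each for the tail of [m] after [T1], the tail of [b] after [T2], and the
     decaying barrier. *)
  destruct (Hlm' (eps / 3)) as [T1 [HT1 Hlm1]]; [lra |].
  destruct (Hlb' (eps / 3)) as [T2 [HT2 Hlb1]]; [lra |].
  destruct (continuous_is_max (fun x => v x T1) 0 (2 * PI)) as [K [HK _]]; [lra | |].
  { intros x. apply jointly_continuous_l, Hcv. }
  assert (HvK : forall x, 0 <= v x T1 <= K).
  { intros x. split.
    - apply Rmult_le_pos; [apply Rlt_le, exp_pos | apply Hk0, Rmax_l].
    - destruct (period_translate 0 x) as [n Hn].
      rewrite <- (periodic_IZR _ n x (Hpv T1)). apply HK. lra. }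
  (* For [t - T1] at least [24 * K / eps], the bound [exp y >= 1 + y] gives
     [exp ((t - T1) / 4) >= 6 * K / eps], which is the decay needed in [Hdecay]. *)
  exists (Rmax T2 (T1 + 24 * K / eps)). intros t Ht. apply HPeps. intros x.
  assert (Hl := Rmax_l T2 (T1 + 24 * K / eps)).
  assert (Hr := Rmax_r T2 (T1 + 24 * K / eps)).
  assert (HK0 : 0 <= K) by (specialize (HvK 0); lra).
  assert (HKe : 0 <= 24 * K / eps) by (apply Rle_mult_inv_pos; lra).
  change (Rabs (k x t * exp (- A0 * t) - (circle_average k0 - lb)) < eps).
  assert (Ev : k x t * exp (- A0 * t) = v x t).
  { unfold v. rewrite Rmax_right by lra. ring. }
  rewrite Ev.
  assert (Eavg : circle_average (fun y => v y t) = circle_average k0 - RInt b 0 t).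
  { rewrite (circle_average_heat g v t) by (auto; lra). f_equal.
    apply circle_average_ext. intros y. unfold v.
    rewrite Rmax_right, Hinit, Rmult_0_r, exp_0 by lra. ring. }
  (* The evolution is restarted at time [T1], so only the integral of [m] from [T1] to [t]
     enters. *)
  assert (Hnear := heat_near_average (fun x s => g x (s + T1)) (fun x s => v x (s + T1))
    (fun s => m (s + T1)) K x (t - T1)).
  replace (t - T1 + T1) with t in Hnear by ring.
  rewrite (RInt_translate m T1 0 (t - T1) Hm), Rplus_0_l in Hnear.
  replace (t - T1 + T1) with t in Hnear by ring.
  rewrite Eavg in Hnear.
  assert (Hshift : forall s : R, continuous (fun r => r + T1) s).
  { intros s. apply (ex_derive_continuous (fun r => r + T1)). auto_derive. trivial. }
  assert (Hfin : Rabs (v x t - (circle_average k0 - RInt b 0 t)) <=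
                 2 * K * exp (- (t - T1) / 4) + RInt m T1 t).
  { apply Hnear.
    - intros q. apply (jointly_continuous_comp v fst (fun q => snd q + T1) q Hcv).
      + apply continuous_fst.
      + apply (continuous_comp snd (fun r => r + T1)); [apply continuous_snd | apply Hshift].
    - intros s. apply Hpv.
    - apply heat_solution_time_shift; [exact HT1 | exact Hheat].
    - intros s. apply (continuous_comp (fun r => r + T1) m); [apply Hshift | apply Hm].
    - intros y s _. apply Hgm.
    - exact HvK.
    - lra. }
  assert (HmT : RInt m T1 t < eps / 3).
  { assert (C := RInt_Chasles_continuous m 0 T1 t Hm).
    specialize (Hlm1 T1). specialize (Hlm t). lra. }
  assert (HbT : Rabs (RInt b 0 t - lb) < eps / 3).
  { specialize (Hlb1 t). specialize (Hlb t). apply Rabs_def1; lra. }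
  assert (Hdecay : 2 * K * exp (- (t - T1) / 4) <= eps / 3).
  { replace (- (t - T1) / 4) with (- ((t - T1) / 4)) by field. rewrite exp_Ropp.
    assert (Hexp1 := exp_ineq1_le ((t - T1) / 4)).
    assert (E : 24 * K / eps * eps = 24 * K) by (field; lra).
    assert (H1 : 6 * K <= eps * exp ((t - T1) / 4)) by nra.
    assert (E1 := exp_pos ((t - T1) / 4)).
    apply (Rmult_le_reg_r (exp ((t - T1) / 4))); [exact E1 |].
    rewrite Rmult_assoc, Rinv_l by lra. lra. }
  apply Rabs_le_between in Hfin. apply Rabs_def2 in HbT. apply Rabs_def1; lra.
Qed.
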